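(* Let $k$ be a field, let $d\geq 2$, let $V_d$ be a $d$-dimensional $k$-vector space with a fixed basis, and take $(v_{i,j})_{1\leq i<j\leq 2d}\in V_d^{d(2d-1)}$. The following are equivalent: (1) $det^{S^2}((v_{i,j})_{1\leq i<j\leq 2d})=0$. (2) There exist $\lambda_{i,j}\in k$ for all $1\leq i<j\leq 2d$, not all zero, such that $$\sum_{s=1}^{r-1}(-1)^{s-1}\lambda_{s,r}v_{s,r}+\sum_{t=r+1}^{2d}(-1)^{t}\lambda_{r,t}v_{r,t}=0$$ for all $1\leq r\leq 2d$.
   Context: Let $\mathcal{B}_d=\{e_1,\dots,e_d\}$ be the fixed basis of $V_d$; vectors of $V_d$ are written as column vectors in $k^d$ with respect to it. An element of $V_d^{d(2d-1)}$ is a family $(v_{i,j})_{1\leq i<j\leq 2d}$ of vectors of $V_d$ indexed by the $d(2d-1)$ pairs $1\leq i<j\leq 2d$. For each $1\leq r\leq 2d$ let $M_r$ be the $d\times d(2d-1)$ matrix whose columns are indexed by the pairs $(i,j)$ with $1\le i<j\le 2d$, listed in the order $(1,2),(1,3),(2,3),(1,4),(2,4),(3,4),(1,5),\dots$ (ordered by $j$ first and then by $i$), where the column indexed by $(s,r)$ with $s<r$ is $(-1)^{s-1}v_{s,r}$, the column indexed by $(r,t)$ with $t>r$ is $(-1)^t v_{r,t}$, and all other columns are $0$. Let $A_1((v_{i,j})_{1\leq i<j\leq 2d})$ be the square $d(2d-1)\times d(2d-1)$ matrix obtained by stacking $M_2,M_3,\dots,M_{2d}$ on top of each other in this order. The map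 $det^{S^2}:V_d^{d(2d-1)}\to k$ is defined by $det^{S^2}((v_{i,j})_{1\leq i<j\leq 2d})=\det\big(A_1((v_{i,j})_{1\leq i<j\leq 2d})\big)$. *)

(* Defs.v *)
From mathcomp Require Import all_boot all_order all_algebra.

Set Implicit Arguments.
Unset Strict Implicit.
Unset Printing Implicit Defensive.

Import GRing.Theory.
Local Open Scope ring_scope.

(* Ordinals start at 0, so the pair (i, j) with 1 <= i < j <= 2d is encoded by
   (i - 1, j - 1); [lo] and [hi] give back i and j themselves. *)
Definition ipair (d : nat) : finType :=
  {p : 'I_(2 * d) * 'I_(2 * d) | (p.1 < p.2)%N}.

Definition lo (d : nat) (p : ipair d) : nat := (val p).1.+1.
Definition hi (d : nat) (p : ipair d) : nat := (val p).2.+1.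

Definition colex (d : nat) : rel (ipair d) := fun p q =>
  (hi p < hi q)%N || (hi p == hi q) && (lo p <= lo q)%N.

Lemma card_ipair (d : nat) : #|ipair d| = (d * (2 * d - 1))%N.
Proof.
rewrite card_sig -sum1_card.
rewrite (eq_bigl (fun p : 'I_(2 * d) * 'I_(2 * d) => true && (p.1 < p.2)%N)) //.
rewrite -(pair_big_dep xpredT (fun i j : 'I_(2 * d) => (i < j)%N) (fun _ _ => 1%N)) /=.
rewrite (exchange_big_dep xpredT) //=.
rewrite (eq_bigr (fun j : 'I_(2 * d) => j : nat)); last first.
  move=> j _; rewrite sum1_card -[RHS]card_ord.
  rewrite -(card_image (f := widen_ord (ltnW (ltn_ord j)))).
    apply: eq_card => i; apply/idP/imageP => [lt_ij | [x _ ->]]; last exact: (ltn_ord x).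
    by exists (Ordinal (lt_ij : (i < j)%N)) => //; apply: val_inj.
  by move=> x y /(congr1 val) /= /val_inj.
rewrite -(big_mkord xpredT (fun i => i)) bin2_sum bin2 subn1.
by rewrite -mulnA mul2n doubleK.
Qed.

Lemma size_sort_ipair (d : nat) :
  size (sort (@colex d) (enum (ipair d))) == (d * (2 * d - 1))%N.
Proof. by rewrite size_sort -cardE card_ipair. Qed.

Definition ipairs (d : nat) : (d * (2 * d - 1)).-tuple (ipair d) :=
  Tuple (size_sort_ipair d).

Definition Mcol (k : fieldType) (d : nat) (V : vectType k)
    (v : ipair d -> V) (r : nat) (p : ipair d) : V :=
  if hi p == r then (-1) ^+ (lo p - 1) *: v p
  else if lo p == r then (-1) ^+ hi p *: v p
  else 0.

(* The index r is the one-based label of the block, as for [lo] and [hi]. *)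
Definition Mblock (k : fieldType) (d : nat) (V : vectType k) (e : d.-tuple V)
    (v : ipair d -> V) (r : nat) : 'M[k]_(d, d * (2 * d - 1)) :=
  \matrix_(a, c) coord e a (Mcol v r (tnth (ipairs d) c)).

Lemma sum_heights (d : nat) : (\sum_(q < 2 * d - 1) d = d * (2 * d - 1))%N.
Proof. by rewrite sum_nat_const card_ord mulnC. Qed.

(* The blocks stacked are those with labels 2, ..., 2d: the one labelled 1 is
   left out, which makes the matrix square. *)
Definition A1 (k : fieldType) (d : nat) (V : vectType k) (e : d.-tuple V)
    (v : ipair d -> V) : 'M[k]_(d * (2 * d - 1)) :=
  castmx (sum_heights d, erefl)
    (\mxcol_(q < 2 * d - 1) Mblock e v (q + 2)).

Definition detS2 (k : fieldType) (d : nat) (V : vectType k) (e : d.-tuple V)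
    (v : ipair d -> V) : k :=
  \det (A1 e v).

(* Main.v *)
Require Import Defs.
From mathcomp Require Import all_boot all_order all_algebra.
From mathcomp Require Import zify.

Set Implicit Arguments.
Unset Strict Implicit.
Unset Printing Implicit Defensive.

Import GRing.Theory.
Local Open Scope ring_scope.

(** Write E_r for the left-hand side of equation r.  Through coordinates in the
    basis e, the matrix A1 applied to the column of the lambda's stacks the
    vectors E_2, ..., E_2d, so its determinant vanishes exactly when some nonzero
    family lambda satisfies the equations r = 2, ..., 2d ([A1_mul_eq0]).  The
    equation r = 1 then comes for free, because the signs are chosen so that the
    alternating sum of all the E_r is zero ([sum_signed_pair_equations]): the
    vector v_(i,j) occurs only in E_j, with sign (-1)^(i-1), and in E_i, with
    sign (-1)^j, and (-1)^j (-1)^(i-1) + (-1)^i (-1)^j = 0. *)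

Lemma lo_lt_hi (d : nat) (p : ipair d) : (lo p < hi p)%N.
Proof. by rewrite ltnS (valP p). Qed.

Lemma hi_le (d : nat) (p : ipair d) : (hi p <= 2 * d)%N.
Proof. exact: ltn_ord. Qed.

Lemma tnth_ipairs_bij (d : nat) : bijective (tnth (ipairs d)).
Proof.
apply: inj_card_bij; last by rewrite card_ord card_ipair.
by apply/tuple_uniqP; rewrite /= sort_uniq enum_uniq.
Qed.

(** The two cases defining [Mcol] never overlap, since lo p < hi p. *)
Lemma McolE (k : fieldType) (d : nat) (V : vectType k)
    (v : ipair d -> V) (r : nat) (p : ipair d) :
  Mcol v r p = (if hi p == r then (-1) ^+ (lo p - 1) *: v p else 0)
             + (if lo p == r then (-1) ^+ hi p *: v p else 0).
Proof.
rewrite /Mcol; case: eqP => [<-|_]; last by rewrite add0r.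
by rewrite (ltn_eqF (lo_lt_hi p)) addr0.
Qed.

(** The vector E_r of the introduction. *)
Definition pair_equation (k : fieldType) (d : nat) (V : vectType k)
    (v : ipair d -> V) (lam : ipair d -> k) (r : nat) : V :=
  \sum_(p : ipair d) lam p *: Mcol v r p.

Lemma pair_equationE (k : fieldType) (d : nat) (V : vectType k)
    (v : ipair d -> V) (lam : ipair d -> k) (r : nat) :
  pair_equation v lam r =
    \sum_(p : ipair d | hi p == r) ((-1) ^+ (lo p - 1) * lam p) *: v p
    + \sum_(p : ipair d | lo p == r) ((-1) ^+ hi p * lam p) *: v p.
Proof.
rewrite big_mkcond [X in _ + X]big_mkcond -big_split /=.
apply: eq_bigr => p _; rewrite McolE scalerDr.
by congr (_ + _); case: ifP => _; rewrite ?scaler0 // scalerA mulrC.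
Qed.

(** Only r = hi p and r = lo p contribute, and their signs are opposite. *)
Lemma sum_signed_Mcol (k : fieldType) (d : nat) (V : vectType k)
    (v : ipair d -> V) (p : ipair d) :
  \sum_(1 <= r < (2 * d).+1) (-1) ^+ r *: Mcol v r p = 0.
Proof.
have lo_le : (lo p <= 2 * d)%N := leq_trans (ltnW (lo_lt_hi p)) (hi_le p).
under eq_bigr => r _.
  rewrite McolE scalerDr !(fun_if (fun x => (-1) ^+ r *: x)) scaler0 !scalerA.
  rewrite ![_ == r]eq_sym; over.
rewrite big_split -!big_mkcond /= !big_nat1_eq /= !ltnS hi_le lo_le.
by rewrite -scalerDl mulrC -mulrDl /lo subn1 exprS mulN1r subrr mul0r scale0r.
Qed.

Lemma sum_signed_pair_equations (k : fieldType) (d : nat) (V : vectType k)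
    (v : ipair d -> V) (lam : ipair d -> k) :
  \sum_(1 <= r < (2 * d).+1) (-1) ^+ r *: pair_equation v lam r = 0.
Proof.
under eq_bigr do rewrite scaler_sumr.
rewrite exchange_big big1 //= => p _.
under eq_bigr do rewrite scalerA mulrC -scalerA.
by rewrite -scaler_sumr sum_signed_Mcol scaler0.
Qed.

(** Equation 1 is, up to sign, the alternating sum of the others. *)
Lemma pair_equations_from2 (k : fieldType) (d : nat) (V : vectType k)
    (v : ipair d -> V) (lam : ipair d -> k) :
  (forall r, (2 <= r <= 2 * d)%N -> pair_equation v lam r = 0) ->
  forall r, (1 <= r <= 2 * d)%N -> pair_equation v lam r = 0.
Proof.
move=> eq_ge2 [|[|r]] // lt_r; last exact: eq_ge2.
have := sum_signed_pair_equations v lam.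
rewrite big_ltn // big_nat big1 ?addr0 => [|r r_range]; last first.
  by rewrite eq_ge2 ?scaler0.
by rewrite expr1 scaleN1r => /eqP; rewrite oppr_eq0 => /eqP.
Qed.

Lemma coord_basis_eq0 (k : fieldType) (d : nat) (V : vectType k)
    (e : d.-tuple V) (he : basis_of fullv e) (x : V) :
  (forall a, coord e a x = 0) -> x = 0.
Proof.
move=> x0; rewrite (coord_basis he (memvf x)).
by rewrite big1 // => a _; rewrite x0 scale0r.
Qed.

Lemma Mblock_mul (k : fieldType) (d : nat) (V : vectType k) (e : d.-tuple V)
    (v : ipair d -> V) (lam : ipair d -> k) (r : nat) :
  Mblock e v r *m (\col_c lam (tnth (ipairs d) c)) =
  \col_a coord e a (pair_equation v lam r).
Proof.
apply/matrixP => a j; rewrite !mxE /pair_equation linear_sum.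
rewrite (reindex (tnth (ipairs d))) /=; last exact/onW_bij/tnth_ipairs_bij.
by apply: eq_bigr => c _; rewrite !mxE linearZ mulrC.
Qed.

Lemma castmx_row_mul_eq0 (R : pzSemiRingType) (m m' n p : nat)
    (eq_m : m = m') (A : 'M[R]_(m, n)) (B : 'M[R]_(n, p)) :
  castmx (eq_m, erefl) A *m B = 0 <-> A *m B = 0.
Proof. by case: m' / eq_m. Qed.

(** Each block of the product lists the coordinates of one E_r in a basis, so
    the block vanishes exactly when E_r does. *)
Lemma A1_mul_eq0 (k : fieldType) (d : nat) (V : vectType k) (e : d.-tuple V)
    (he : basis_of fullv e) (v : ipair d -> V) (lam : ipair d -> k) :
  A1 e v *m (\col_c lam (tnth (ipairs d) c)) = 0 <->
  forall r, (2 <= r <= 2 * d)%N -> pair_equation v lam r = 0.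
Proof.
rewrite /A1; apply: (iff_trans (castmx_row_mul_eq0 _ _ _)).
rewrite mxcol_mul -[X in _ = X <-> _]mxcol0 -eq_mxcolP.
split=> [blocks0 r /andP[r_ge2 r_le] | eqs q].
  have lt_q : (r - 2 < 2 * d - 1)%N by lia.
  apply: (coord_basis_eq0 he) => a.
  have := blocks0 (Ordinal lt_q); rewrite /= subnK // Mblock_mul.
  by move/matrixP/(_ a 0); rewrite !mxE.
rewrite Mblock_mul eqs; last by have := ltn_ord q; lia.
by apply/matrixP => a j; rewrite !mxE linear0.
Qed.

Theorem proposition4p1 (k : fieldType) (d : nat) (hd : (2 <= d)%N)
    (V : vectType k) (e : d.-tuple V) (he : basis_of fullv e)
    (v : ipair d -> V) :
  detS2 e v = 0 <->
  exists lam : ipair d -> k,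
    (exists p : ipair d, lam p != 0) /\
    (forall r : nat, (1 <= r <= 2 * d)%N ->
       \sum_(p : ipair d | hi p == r) ((-1) ^+ (lo p - 1) * lam p) *: v p
       + \sum_(p : ipair d | lo p == r) ((-1) ^+ hi p * lam p) *: v p = 0).
Proof.
have [rank rankK tnthK] := tnth_ipairs_bij d.
(* [det0P] speaks of row vectors, hence the transposes. *)
rewrite /detS2 -det_tr; split=> [/eqP/det0P[u u_neq0 uA0] | [lam [[p lam_p] eqs]]].
  pose lam p := u 0 (rank p); exists lam.
  have uE : u^T = \col_c lam (tnth (ipairs d) c).
    by apply/matrixP => c j; rewrite !mxE /lam rankK ord1.
  have Alam0 : A1 e v *m u^T = 0.
    by apply: trmx_inj; rewrite trmx_mul trmxK uA0 trmx0.
  split.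
    by have /rV0Pn[c u_c] := u_neq0; exists (tnth (ipairs d) c); rewrite /lam rankK.
  move=> r r_range; rewrite -pair_equationE; apply: pair_equations_from2 r_range.
  by apply/(A1_mul_eq0 he); rewrite -uE.
apply/eqP/det0P; exists (\row_c lam (tnth (ipairs d) c)).
  by apply/rV0Pn; exists (rank p); rewrite mxE tnthK.
apply: trmx_inj; rewrite trmx_mul trmxK trmx0.
have -> : (\row_c lam (tnth (ipairs d) c))^T = \col_c lam (tnth (ipairs d) c).
  by apply/matrixP => c j; rewrite !mxE.
apply/(A1_mul_eq0 he) => r /andP[r_ge2 r_le].
by rewrite pair_equationE eqs // (ltnW r_ge2).
Qed.
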